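(* Let $d\ge 2$ with $d\equiv 2\pmod 4$. In frequency order, every minimum cardinality positively weighted extremal design of the hypercube graph $Q_d$ consists of $2^{d-1}$ vertices and is combinatorial. For every $x\in\{0,1\}^d$ with exactly $d/2$ ones, the linear code $\ker(x^\top)=\{y\in\{0,1\}^d: x^\top y\equiv0 \bmod 2\}$ is a positively weighted extremal design attaining this minimum.
   Context: $Q_d$ is the edge graph of the $d$-dimensional hypercube: vertex set $\{0,1\}^d$, two vertices adjacent iff they differ in exactly one coordinate; it is $d$-regular. Its eigenvalues and eigenspaces are those of $\frac1dA$ with $A$ the adjacency matrix: for $i=0,\dots,d$ the eigenvalue $1-2i/d$ has eigenspace $\Lambda_i$ with basis $\{\phi_x : x\in\{0,1\}^d,\ |x|=i\}$, where $\phi_x(y)=(-1)^{x^\top y}$ and $|x|$ is the number of ones in $x$. Frequency order means that the eigenspaces are ordered by decreasing absolute value of the eigenvalue, with $\Lambda_0=\operatorname{span}\{\mathbb{1}\}$ first; for even $d$ the last eigenspace is $\Lambda_{d/2}$ (eigenvalue $0$). A vertex subset $W$ with weights $(a_w)_{w\in W}$ averages an eigenspace $\Lambda$ if $\sum_{w\in W}a_w\phi(w)=\frac1{2^d}\sum_{y\in\{0,1\}^d}\phi(y)$ for all $\phi\in\Lambda$. $W$ is a positively weighted extremal design if there are weights $a_w>0$ with which $W$ averages all eigenspaces except the last one, and a combinatorial one if this holds with $a_w=1/|W|$ for all $w$. *)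

(* Defs.v *)
From mathcomp Require Import all_boot all_order all_algebra.

Set Implicit Arguments.
Unset Strict Implicit.
Unset Printing Implicit Defensive.

Import Order.TTheory GRing.Theory Num.Theory.
Local Open Scope ring_scope.

Definition cube (d : nat) := {ffun 'I_d -> bool}.

Definition cube_adj (d : nat) : rel (cube d) :=
  fun x y => #|[set i | x i != y i]| == 1%N.

Definition weight (d : nat) (x : cube d) : nat := #|[set i | x i]|.

Definition dot (d : nat) (x y : cube d) : nat := (\sum_(i < d) x i * y i)%N.

Definition ker_code (d : nat) (x : cube d) : {set cube d} :=
  [set y | dot x y == 0 %[mod 2]].

(* Vertices index matrices and vectors through [enum_val] / [enum_rank]. *)
Definition adjacency_mx (R : realFieldType) (T : finType) (e : rel T) :
    'M[R]_#|T| :=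
  \matrix_(i, j) (e (enum_val i) (enum_val j))%:R.

Definition value (R : realFieldType) (T : finType) (phi : 'rV[R]_#|T|) (t : T)
    : R :=
  phi 0 (enum_rank t).

Definition cube_mx (R : realFieldType) (d : nat) : 'M[R]_#|cube d| :=
  d%:R^-1 *: adjacency_mx R (@cube_adj d).

(* An eigenspace is represented by its eigenvalue; ties in absolute value may  *)
(* be broken arbitrarily, except that the eigenvalue 1 (constants) is first.   *)
Definition frequency_order (R : realFieldType) (d : nat) (s : seq R) : Prop :=
  [/\ uniq s,
      forall l : R, (l \in s) = eigenvalue (cube_mx R d) l,
      sorted (fun l m : R => `|m| <= `|l|) s
    & head 0 s = 1].

(* [eigenspace] is a space of row vectors; [cube_mx] is symmetric, so left and *)
(* right eigenvectors coincide.                                                *)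
Definition averages (R : realFieldType) (d : nat) (W : {set cube d})
    (a : cube d -> R) (l : R) : Prop :=
  forall phi : 'rV[R]_#|cube d|, (phi <= eigenspace (cube_mx R d) l)%MS ->
    \sum_(w in W) a w * value phi w = (2 ^ d)%:R^-1 * \sum_y value phi y.

Definition averages_all_but_last (R : realFieldType) (d : nat) (s : seq R)
    (W : {set cube d}) (a : cube d -> R) : Prop :=
  forall i : nat, (i < (size s).-1)%N -> averages W a s`_i.

Definition positive_extremal_design (R : realFieldType) (d : nat) (s : seq R)
    (W : {set cube d}) : Prop :=
  exists a : cube d -> R,
    (forall w, w \in W -> 0 < a w) /\ averages_all_but_last s W a.

Definition combinatorial_extremal_design (R : realFieldType) (d : nat)
    (s : seq R) (W : {set cube d}) : Prop :=
  averages_all_but_last s W (fun=> #|W|%:R^-1).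

Definition minimum_positive_extremal_design (R : realFieldType) (d : nat)
    (s : seq R) (W : {set cube d}) : Prop :=
  positive_extremal_design s W /\
  forall W' : {set cube d}, positive_extremal_design s W' -> (#|W| <= #|W'|)%N.

(* Main.v *)
Require Import Defs.
From mathcomp Require Import all_boot all_order all_algebra.
From mathcomp Require Import ring.

Set Implicit Arguments.
Unset Strict Implicit.
Unset Printing Implicit Defensive.

Import Order.TTheory GRing.Theory Num.Theory.
Local Open Scope ring_scope.

(** Write m = d/2, which is odd because d is 2 modulo 4.  The last eigenspace
    is the one of the eigenvalue 0, spanned by the characters chi_x with
    |x| = m.  Extend the weights of a design W by zero to a function f on the
    cube.  Averaging every other eigenspace says that f - 2^-d is orthogonal to
    every chi_x with |x| <> m, hence to every chi_x with |x| even.  Passing to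
    the antipode of y multiplies chi_x(y) by (-1)^|x|, so Fourier inversion
    shows that f - 2^-d is an odd function for the antipodal involution:

      f(y) + f(antipode y) = 2^(1-d)    for every vertex y.

    ([antipodal_sum0], [averages_antipode].)  The right-hand side is positive,
    so W meets each of the 2^(d-1) antipodal pairs, which is the lower bound on
    the cardinality.  If the bound is attained, W meets each pair exactly once,
    one of the two terms is zero, and every weight is equal to 2^(1-d): the
    design is combinatorial ([antipodal_cover]).

    The bound is attained by the codes ker(x^T) with |x| = m: their indicator
    is (1 + chi_x) / 2, and chi_x is orthogonal to every eigenspace of a nonzero
    eigenvalue since the matrix is symmetric ([ker_code_averages]). *)

(** * Antipodes, flips and characters of the cube *)

Definition antipode d (y : cube d) : cube d := [ffun i => ~~ y i].

Definition flip d (y : cube d) (i : 'I_d) : cube d :=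
  [ffun j => y j (+) (j == i)].

Definition chi (R : realFieldType) d (x y : cube d) : R := (-1) ^+ dot x y.

Definition chi_row (R : realFieldType) d (x : cube d) : 'rV[R]_#|cube d| :=
  \row_j chi R x (enum_val j).

Lemma card_cube d : #|cube d| = (2 ^ d)%N.
Proof. by rewrite card_ffun card_bool card_ord. Qed.

Lemma double_expn2_pred d : (0 < d)%N -> (2 * 2 ^ (d - 1) = 2 ^ d)%N.
Proof. by move=> d_gt0; rewrite -expnS subn1 prednK. Qed.

Lemma antipodeK d : involutive (@antipode d).
Proof. by move=> y; apply/ffunP=> i; rewrite !ffunE negbK. Qed.

Lemma weightE d (x : cube d) : weight x = (\sum_i x i)%N.
Proof.
rewrite /weight -sum1_card big_mkcond /=; apply: eq_bigr => i _.
by rewrite inE; case: (x i).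
Qed.

Lemma exists_weight d k : (k <= d)%N -> exists x : cube d, weight x = k.
Proof.
move=> le_kd; have: (0 < #|[set A : {set 'I_d} | #|A| == k]|)%N.
  by rewrite card_draws card_ord bin_gt0.
case/card_gt0P=> A; rewrite inE => /eqP cardA.
exists [ffun i => i \in A]; rewrite -cardA /weight.
by apply: eq_card => i; rewrite !inE ffunE.
Qed.

(** * Vectors indexed by vertices, and orthogonality of eigenspaces *)

Section Value.
Variable R : realFieldType.

Lemma sum_enum_val (T : finType) (F : T -> R) :
  \sum_(k < #|T|) F (enum_val k) = \sum_t F t.
Proof. by rewrite [RHS](reindex _ (onW_bij _ (enum_val_bij T))). Qed.

Lemma value_enum_val (T : finType) (phi : 'rV[R]_#|T|) k :
  phi 0 k = value phi (enum_val k).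
Proof. by rewrite /value enum_valK. Qed.

Lemma value_chi d (x y : cube d) : value (chi_row R x) y = chi R x y.
Proof. by rewrite /value mxE enum_rankK. Qed.

(** Moving the symmetric matrix from one side of the product to the other
    multiplies it by l as well as by m. *)
Lemma eigenspaces_orthogonal n (M : 'M[R]_n) (l m : R) (u v : 'rV[R]_n) :
  M^T = M -> l != m -> (u <= eigenspace M l)%MS -> (v <= eigenspace M m)%MS ->
  u *m v^T = 0.
Proof.
move=> symM ne_lm /eigenspaceP uM /eigenspaceP vM.
have: l *: (u *m v^T) = m *: (u *m v^T).
  by rewrite scalemxAl -uM -{1}symM -mulmxA -trmx_mul vM linearZ scalemxAr.
move/eqP; rewrite -subr_eq0 -scalerBl scaler_eq0 subr_eq0 (negPf ne_lm) /=.
by move/eqP.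
Qed.

(** * Characters as eigenvectors *)

Section Cube.
Variable d : nat.
Implicit Types x y z : cube d.

Lemma cube_adj_sym : symmetric (@cube_adj d).
Proof.
move=> y z; rewrite /cube_adj; congr (_ == _).
by apply: eq_card => i; rewrite !inE eq_sym.
Qed.

Lemma cube_mx_sym : (cube_mx R d)^T = cube_mx R d.
Proof. by apply/matrixP=> i j; rewrite !mxE cube_adj_sym. Qed.

Lemma flip_inj y : injective (flip y).
Proof.
move=> i j /ffunP/(_ i); rewrite !ffunE eqxx => /addbI.
by move/esym/eqP.
Qed.

Lemma cube_adjE z y : cube_adj z y = (z \in [set flip y i | i : 'I_d]).
Proof.
apply/idP/imsetP=> [/cards1P[i eq_i] | [i _ ->]].
  exists i => //; apply/ffunP=> j; rewrite ffunE.
  by have /setP/(_ j) := eq_i; rewrite !inE => <-; case: (z j); case: (y j).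
apply/cards1P; exists i; apply/setP=> j; rewrite !inE ffunE.
by case: (j == i); case: (y j).
Qed.

Lemma sum_neighbours y (F : cube d -> R) :
  \sum_(z | cube_adj z y) F z = \sum_(i < d) F (flip y i).
Proof.
under eq_bigl do rewrite cube_adjE.
by rewrite big_imset //= => i j _ _ /flip_inj.
Qed.

Lemma chi_prod x y : chi R x y = \prod_i (-1) ^+ (x i * y i)%N.
Proof. exact: expr_sum. Qed.

Lemma chi_flip x y i : chi R x (flip y i) = (-1) ^+ x i * chi R x y.
Proof.
rewrite !chi_prod (bigD1 i) //= [in RHS](bigD1 i) //= mulrA ffunE eqxx.
congr (_ * _).
  by case: (x i); case: (y i); rewrite /= ?expr0 ?expr1 ?mulN1r ?opprK ?mulr1.
by apply: eq_bigr => j ne_ji; rewrite ffunE (negPf ne_ji) addbF.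
Qed.

Lemma odd_dot_antipode x y :
  odd (dot x (antipode y)) = odd (weight x) (+) odd (dot x y).
Proof.
have <- : (dot x (antipode y) + dot x y)%N = weight x.
  rewrite weightE /dot -big_split /=; apply: eq_bigr => i _.
  by rewrite ffunE; case: (x i); case: (y i).
by rewrite oddD addbK.
Qed.

Lemma chi_antipode x y : chi R x (antipode y) = (-1) ^+ weight x * chi R x y.
Proof.
by rewrite /chi -signr_odd odd_dot_antipode signr_addb !signr_odd.
Qed.

Lemma sum_sign x : \sum_(i < d) (-1) ^+ x i = d%:R - (2 * weight x)%:R :> R.
Proof.
apply/eqP; rewrite eq_sym subr_eq; apply/eqP.
rewrite weightE big_distrr /= natr_sum -big_split /=.
rewrite -[in LHS](card_ord d) -sum1_card natr_sum; apply: eq_bigr => i _.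
by case: (x i); rewrite /= ?expr0 ?expr1 ?addr0 //; ring.
Qed.

(** The d neighbours of y are its flips, and flipping coordinate i multiplies
    chi_x(y) by (-1)^(x_i); these signs add up to d - 2 |x|. *)
Lemma chi_eigen x : (0 < d)%N ->
  (chi_row R x <= eigenspace (cube_mx R d) (1 - (2 * weight x)%:R / d%:R))%MS.
Proof.
move=> d_gt0; apply/eigenspaceP/rowP=> j; rewrite !mxE.
set y := enum_val j.
have -> : \sum_k chi_row R x 0 k * cube_mx R d k j
    = d%:R^-1 * \sum_(z | cube_adj z y) chi R x z.
  rewrite mulr_sumr [RHS]big_mkcond -[RHS]sum_enum_val; apply: eq_bigr => k _.
  by rewrite !mxE; case: cube_adj; rewrite /= ?mulr1 ?mulr0 // mulrC.
rewrite sum_neighbours; under eq_bigr do rewrite chi_flip.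
rewrite -mulr_suml sum_sign mulrA mulrBr mulVf ?pnatr_eq0 -?lt0n //.
by rewrite [_ / _]mulrC.
Qed.

Lemma chi_eigenvalue x : (0 < d)%N ->
  eigenvalue (cube_mx R d) (1 - (2 * weight x)%:R / d%:R).
Proof.
move=> d_gt0; apply/eigenvalueP; exists (chi_row R x).
  exact/eigenspaceP/chi_eigen.
apply/eqP=> /rowP/(_ (enum_rank x))/eqP.
by rewrite !mxE signr_eq0.
Qed.

Lemma chi_eigenvalue_eq0 x : (0 < d)%N ->
  (1 - (2 * weight x)%:R / d%:R == 0 :> R) = (2 * weight x == d)%N.
Proof.
move=> d_gt0; have d_neq0 : d%:R != 0 :> R by rewrite pnatr_eq0 -lt0n.
by rewrite subr_eq0 eq_sym -(inj_eq (mulIf d_neq0)) divfK // mul1r eqr_nat.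
Qed.

(** * Fourier inversion and odd functions *)

(** The sum factors over the coordinates, and a coordinate on which y and z
    differ contributes 1 - 1 = 0. *)
Lemma chi_inversion y z : \sum_x chi R x y * chi R x z = (2 ^ d * (y == z))%:R.
Proof.
pose F i (b : bool) : R := (-1) ^+ (b * y i)%N * (-1) ^+ (b * z i)%N.
have -> : \sum_x chi R x y * chi R x z = \prod_i \sum_b F i b.
  rewrite bigA_distr_bigA; apply: eq_bigr => x _.
  by rewrite !chi_prod -big_split.
have sumF i : \sum_b F i b = (2 * (y i == z i))%:R.
  rewrite big_bool /F !mul1n !mul0n; case: (y i); case: (z i) => /=; ring.
rewrite (eq_bigr _ (fun i _ => sumF i)).
have [<-|ne_yz] := eqVneq y z.
  under eq_bigr do rewrite eqxx.
  by rewrite prodr_const card_ord -natrX !muln1.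
have /existsP[i ne_i] : [exists i, y i != z i].
  rewrite -negb_forall; apply: contra ne_yz => /forallP eq_yz.
  by apply/eqP/ffunP=> i; apply/eqP.
by rewrite muln0 (bigD1 i) //= (negPf ne_i) mul0r.
Qed.

(** Expanding g(y) + g(antipode y) in characters, the terms with |x| odd cancel
    by the sign of chi_x under the antipode, and those with |x| even vanish by
    the hypothesis. *)
Lemma antipodal_sum0 (g : cube d -> R) :
    (forall x, ~~ odd (weight x) -> \sum_y g y * chi R x y = 0) ->
  forall y, g y + g (antipode y) = 0.
Proof.
move=> g_even y.
have inv z : \sum_x (\sum_t g t * chi R x t) * chi R x z = (2 ^ d)%:R * g z.
  under eq_bigr do rewrite mulr_suml.
  rewrite exchange_big /= (bigD1 z) //= [X in _ + X]big1 => [|t ne_tz].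
    under eq_bigr do rewrite -mulrA.
    by rewrite -mulr_sumr chi_inversion eqxx muln1 addr0 mulrC.
  under eq_bigr do rewrite -mulrA.
  by rewrite -mulr_sumr chi_inversion (negPf ne_tz) muln0 mulr0.
have: (2 ^ d)%:R * (g y + g (antipode y)) = 0.
  rewrite mulrDr -!inv -big_split big1 //= => x _.
  rewrite chi_antipode -signr_odd.
  have [_|/g_even->] := boolP (odd _); last by rewrite !mul0r addr0.
  by rewrite mulN1r mulrN subrr.
by move/eqP; rewrite mulf_eq0 pnatr_eq0 expn_eq0 /= => /eqP.
Qed.

(** * The last eigenspace and the averaging conditions *)

(** Turns positions in a frequency order into eigenvalues: an eigenvalue 0 has
    the smallest absolute value, so it comes last, and it comes only once. *)
Lemma averages_all_but_lastP (s : seq R) (W : {set cube d}) a :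
    frequency_order d s -> eigenvalue (cube_mx R d) 0 ->
  averages_all_but_last s W a <->
  forall l, eigenvalue (cube_mx R d) l -> l != 0 -> averages W a l.
Proof.
case=> s_uniq s_eig s_sorted _ eig0.
have s0 : 0 \in s by rewrite s_eig.
have s_gt0 : (0 < size s)%N by case: (s) s0.
have last_lt : ((size s).-1 < size s)%N by rewrite prednK.
have last0 : s`_(size s).-1 = 0.
  have abs_trans : transitive (fun l m : R => `|m| <= `|l|).
    by move=> y x z le_yx le_zy; apply: le_trans le_yx.
  have abs_refl : reflexive (fun l m : R => `|m| <= `|l|) by move=> ?.
  have idx_lt : (index 0%R s < size s)%N by rewrite index_mem.
  have := sorted_leq_nth abs_trans abs_refl 0 s_sorted.
  move=> /(_ _ _ idx_lt last_lt); rewrite -ltnS prednK // => /(_ idx_lt).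
  by rewrite nth_index // normr0 normr_le0 => /eqP.
split=> [avg l eig_l l_neq0 | avg i lt_i].
  have s_l : l \in s by rewrite s_eig.
  rewrite -(nth_index 0 s_l); apply: avg.
  rewrite ltn_neqAle -ltnS prednK // index_mem s_l andbT.
  by apply: contraNneq l_neq0 => idx_l; rewrite -(nth_index 0 s_l) idx_l last0.
have lt_is : (i < size s)%N by apply: leq_trans lt_i (leq_pred _).
apply: avg; first by rewrite -s_eig mem_nth.
by rewrite -[X in _ != X]last0 nth_uniq // neq_ltn lt_i.
Qed.

(** The weights extended by zero differ from the uniform density 2^-d by a
    function to which [antipodal_sum0] applies: a chi_x of eigenvalue 0 has
    |x| = d/2, which is odd. *)
Lemma averages_antipode (W : {set cube d}) (a : cube d -> R) :
    (0 < d)%N -> odd d./2 ->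
    (forall l, eigenvalue (cube_mx R d) l -> l != 0 -> averages W a l) ->
  forall y, (if y \in W then a y else 0)
    + (if antipode y \in W then a (antipode y) else 0) = 2 * (2 ^ d)%:R^-1.
Proof.
move=> d_gt0 odd_m avg y.
pose g z := (if z \in W then a z else 0) - (2 ^ d)%:R^-1.
suff: g y + g (antipode y) = 0.
  by move/eqP; rewrite /g addrACA -opprD subr_eq0 => /eqP->; ring.
apply: antipodal_sum0 => x even_x.
have l_neq0 : 1 - (2 * weight x)%:R / d%:R != 0 :> R.
  rewrite chi_eigenvalue_eq0 //; apply: contra even_x => /eqP xd.
  by rewrite -xd mul2n doubleK in odd_m.
have := avg _ (chi_eigenvalue x d_gt0) l_neq0 _ (chi_eigen x d_gt0).
under eq_bigr do rewrite value_chi.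
under [in RHS]eq_bigr do rewrite value_chi.
rewrite big_mkcond mulr_sumr => /eqP; rewrite -subr_eq0 -sumrB => /eqP sum0.
rewrite -[RHS]sum0; apply: eq_bigr => z _.
by rewrite /g mulrBl; case: ifP; rewrite ?mul0r.
Qed.

(** * Sets that meet every antipodal pair *)

(** W and its antipodal image W' have the same cardinality and cover the cube,
    so #|W :&: W'| = 2 #|W| - 2^d. *)
Lemma antipodal_cover (W : {set cube d}) :
    (0 < d)%N -> (forall y, (y \in W) || (antipode y \in W)) ->
  (2 ^ (d - 1) <= #|W|)%N /\
  (#|W| = (2 ^ (d - 1))%N -> forall y, y \in W -> antipode y \notin W).
Proof.
move=> d_gt0 cover; pose W' : {set cube d} := @antipode d @^-1: W.
have cardW' : #|W'| = #|W|.
  apply: on_card_preimset; exists (@antipode d) => z _; exact: antipodeK.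
have cardUI : (#|W :&: W'| + 2 * 2 ^ (d - 1) = 2 * #|W|)%N.
  rewrite double_expn2_pred // -card_cube.
  have <- : #|W :|: W'| = #|cube d|.
    by rewrite -cardsT; apply: eq_card => z; rewrite !inE cover.
  by rewrite addnC cardsUI cardW' addnn mul2n.
split=> [|cardW y yW].
  by rewrite -(leq_pmul2l (ltn0Sn 1)) -cardUI leq_addl.
have /eqP : #|W :&: W'| = 0%N.
  by apply/eqP; rewrite -(eqn_add2r (2 * 2 ^ (d - 1))) cardUI cardW.
rewrite cards_eq0 => /eqP/setP/(_ y).
by rewrite !inE yW => /= ->.
Qed.

(** * The codes ker(x^T) *)

Lemma mem_ker_code x y : (y \in ker_code x) = ~~ odd (dot x y).
Proof. by rewrite inE eqn_mod_dvd // subn0 dvdn2. Qed.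

Lemma ker_code_indicator x y :
  (y \in ker_code x)%:R = (1 + chi R x y) / 2 :> R.
Proof.
rewrite mem_ker_code /chi -signr_odd.
by case: odd => /=; rewrite ?expr0 ?expr1; field.
Qed.

(** For |x| odd the antipode exchanges the code with its complement. *)
Lemma card_ker_code x :
  (0 < d)%N -> odd (weight x) -> #|ker_code x| = (2 ^ (d - 1))%N.
Proof.
move=> d_gt0 odd_x.
have kerC : ~: ker_code x = @antipode d @^-1: ker_code x.
  apply/setP=> y.
  by rewrite in_setC [RHS]inE !mem_ker_code odd_dot_antipode odd_x.
have := cardsC (ker_code x).
rewrite kerC on_card_preimset; last first.
  by exists (@antipode d) => z _; apply: antipodeK.
rewrite card_cube addnn -mul2n -(double_expn2_pred d_gt0) => /eqP.
by rewrite eqn_pmul2l // => /eqP.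
Qed.

(** By [ker_code_indicator] the sum of phi over the code is half its total plus
    half its product with chi_x; here chi_x has eigenvalue 0 <> l. *)
Lemma ker_code_averages x (l : R) :
    (0 < d)%N -> odd (weight x) -> (2 * weight x)%N = d -> l != 0 ->
  averages (ker_code x) (fun=> #|ker_code x|%:R^-1) l.
Proof.
move=> d_gt0 odd_x xd l_neq0 phi phi_l.
have chi0 : \sum_y chi R x y * value phi y = 0.
  have eig0 := chi_eigen x d_gt0; have := chi_eigenvalue_eq0 x d_gt0.
  rewrite xd eqxx => /eqP x0; rewrite xd x0 in eig0.
  have := eigenspaces_orthogonal cube_mx_sym l_neq0 phi_l eig0.
  move=> /matrixP/(_ 0 0); rewrite !mxE => orth; rewrite -[RHS]orth.
  rewrite -[LHS]sum_enum_val; apply: eq_bigr => k _.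
  by rewrite -value_enum_val !mxE mulrC.
rewrite card_ker_code // -mulr_sumr.
have -> : \sum_(w in ker_code x) value phi w = 2^-1 * \sum_y value phi y.
  transitivity (2^-1 * (\sum_y value phi y + \sum_y chi R x y * value phi y)).
    rewrite -big_split mulr_sumr [LHS]big_mkcond /=; apply: eq_bigr => y _.
    by rewrite -mulrb -[LHS]mulr_natl ker_code_indicator; field.
  by rewrite chi0 addr0.
by rewrite mulrA -invfM -natrM mulnC double_expn2_pred.
Qed.

End Cube.
End Value.

(** * Minimum designs *)

Theorem theorem5p13 (R : realFieldType) (d : nat)
    (d_ge2 : (2 <= d)%N) (d_mod4 : (d = 2 %[mod 4])%N)
    (s : seq R) (s_freq : frequency_order d s) :
  (forall W : {set cube d}, minimum_positive_extremal_design s W ->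
     #|W| = (2 ^ (d - 1))%N /\ combinatorial_extremal_design s W) /\
  (forall x : cube d, weight x = (d %/ 2)%N ->
     minimum_positive_extremal_design s (ker_code x)).
Proof.
have d_gt0 : (0 < d)%N by apply: leq_trans d_ge2.
have [odd_m dE] : odd (d %/ 2) /\ (2 * (d %/ 2))%N = d.
  have := divn_eq d 4; rewrite d_mod4 => ->.
  rewrite -[4%N]/(2 * 2)%N mulnA [(2 %% _)%N]/= divnMDl // divnn /=.
  by rewrite oddD oddM /= andbF; split=> //; rewrite mulnDr muln1 mulnC.
have odd_half : odd d./2 by rewrite -divn2.
have halfW (x : cube d) : weight x = (d %/ 2)%N -> (2 * weight x)%N = d.
  by move=> ->.
have [x0 x0m] : exists x : cube d, weight x = (d %/ 2)%N.
  by apply: exists_weight; apply: leq_div.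
have eig0 : eigenvalue (cube_mx R d) 0.
  have /eqP <- : 1 - (2 * weight x0)%:R / d%:R == 0 :> R.
    by rewrite chi_eigenvalue_eq0 // halfW.
  exact: chi_eigenvalue.
have avgP W a := averages_all_but_lastP W a s_freq eig0.
have bound_pos : 0 < 2 * (2 ^ d)%:R^-1 :> R.
  by rewrite mulr_gt0 ?invr_gt0 ?ltr0n ?expn_gt0.
have cover (W : {set cube d}) a : averages_all_but_last s W a ->
    forall y, (y \in W) || (antipode y \in W).
  (* If W missed both vertices, their weights would add up to 0. *)
  move=> /avgP avg y; apply: contraLR bound_pos; rewrite negb_or.
  rewrite -(averages_antipode d_gt0 odd_half avg y).
  by case/andP=> /negPf-> /negPf->; rewrite addr0 ltxx.
have lower (W : {set cube d}) :
    positive_extremal_design s W -> (2 ^ (d - 1) <= #|W|)%N.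
  by case=> a [_ /cover cov]; have [] := antipodal_cover d_gt0 cov.
have kerP (x : cube d) : weight x = (d %/ 2)%N ->
    minimum_positive_extremal_design s (ker_code x).
  move=> xm; have odd_x : odd (weight x) by rewrite xm.
  have card_x := card_ker_code d_gt0 odd_x.
  split=> [|W' /lower]; last by rewrite card_x.
  exists (fun=> #|ker_code x|%:R^-1); split=> [w _|].
    by rewrite card_x invr_gt0 ltr0n expn_gt0.
  by apply/avgP=> l _ l_neq0; apply: ker_code_averages => //; apply: halfW.
split=> // W [[a [a_gt0 avg]] W_min].
have [W_ge W_anti] := antipodal_cover d_gt0 (cover _ _ avg).
have cardW : #|W| = (2 ^ (d - 1))%N.
  apply/eqP; rewrite eqn_leq W_ge andbT.
  have [ker_design _] := kerP x0 x0m.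
  by rewrite -(card_ker_code (x := x0)) ?x0m //; apply: W_min.
(* The antipode of w lies outside W, so w alone carries the weight 2^(1-d) of
   its pair. *)
have aE w : w \in W -> a w = #|W|%:R^-1.
  move=> wW.
  have := averages_antipode d_gt0 odd_half ((avgP _ _).1 avg) w.
  rewrite wW (negPf (W_anti cardW w wW)) addr0 cardW => ->.
  by rewrite -(double_expn2_pred d_gt0) natrM invfM mulVKf // pnatr_eq0.
split=> // i lt_i phi phi_i; rewrite -(avg i lt_i phi phi_i).
by apply: eq_bigr => w wW; rewrite aE.
Qed.
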